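(* Let $A\in\mathbb{R}^{n\times n}$, $B\in\mathbb{R}^{n\times m}$, let $Q\in\mathbb{R}^{n\times n}$ and $R\in\mathbb{R}^{m\times m}$ be symmetric positive semidefinite, and let $P\in\mathbb{R}^{n\times n}$ be the (symmetric) stabilizing solution of the discrete-time algebraic Riccati equation (DARE) $$P = A^\top P A - A^\top P B\,(R + B^\top P B)^{-1} B^\top P A + Q .$$ Assume that $(R+B^\top P B)^{-1}$ exists, and define $$M_3 := R + B^\top P B,\qquad M_2 := M_3^{-1},\qquad M_1 := P - P B M_2 B^\top P,$$ \begin{align*} Z_1 &:= \mathbf{I}_{n^2} - (A^\top \otimes A^\top)\big[\mathbf{I}_{n^2} - (PBM_2B^\top \otimes \mathbf{I}_n) - (\mathbf{I}_n \otimes PBM_2B^\top) + (PB\otimes PB)(M_2\otimes M_2)(B^\top\otimes B^\top)\big],\\ Z_2 &:= (\mathbf{V}_{n,n} + \mathbf{I}_{n^2})(\mathbf{I}_n\otimes A^\top M_1),\\ Z_3 &:= (A^\top\otimes A^\top)\big[(PB\otimes PB)(M_2\otimes M_2)(\mathbf{I}_{m^2}+\mathbf{V}_{m,m})(\mathbf{I}_m\otimes B^\top P) - (\mathbf{I}_{n^2}+\mathbf{V}_{n,n})(PBM_2\otimes P)\big],\\ Z_4 &:= \mathbf{I}_{n^2},\\ Z_5 &:= (A^\top\otimes A^\top)(PB\otimes PB)(M_2\otimes M_2). \end{align*} Assume also that $Z_1^{-1}$ exists. Then the Jacobians, at $(A,B,Q,R)$, of the implicit function $(A,B,Q,R)\mapsto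 P$ defined by the DARE are given by $$\frac{\partial\,\mathrm{vec}\,P}{\partial\,\mathrm{vec}\,A} = Z_1^{-1}Z_2,\qquad \frac{\partial\,\mathrm{vec}\,P}{\partial\,\mathrm{vec}\,B} = Z_1^{-1}Z_3,\qquad \frac{\partial\,\mathrm{vec}\,P}{\partial\,\mathrm{vec}\,Q} = Z_1^{-1}Z_4,\qquad \frac{\partial\,\mathrm{vec}\,P}{\partial\,\mathrm{vec}\,R} = Z_1^{-1}Z_5 .$$
   Context: Notation. $\mathbf{I}_k$ is the $k\times k$ identity matrix. $\rho(\cdot)$ denotes the spectral radius (largest absolute value of an eigenvalue). $\mathrm{vec}:\mathbb{R}^{p\times q}\to\mathbb{R}^{pq}$ stacks the columns of a matrix into a vector: $\mathrm{vec}([c_1\ \cdots\ c_q]) = (c_1,\dots,c_q)$. $\mathbf{V}_{p,q}\in\mathbb{R}^{pq\times pq}$ is the permutation matrix defined by $\mathbf{V}_{p,q}\,\mathrm{vec}\,X = \mathrm{vec}\,X^\top$ for all $X\in\mathbb{R}^{p\times q}$. $\otimes$ is the standard Kronecker product, so that $\mathrm{vec}(XYW) = (W^\top\otimes X)\,\mathrm{vec}\,Y$. Stabilizing solution. A solution $P$ of the DARE is called stabilizing if $\rho(A+BK)\le 1$, where $K = -(R+B^\top P B)^{-1}B^\top P A$ is the associated linear quadratic regulator gain. Implicit function and Jacobians. The DARE is regarded as an equation implicitly defining $P$ as a function of $(A,B,Q,R)$ in a neighbourhood of the given data, taking the given stabilizing solution as its value at the given data. For $X\in\{A,B,Q,R\}$,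 $\partial\,\mathrm{vec}\,P/\partial\,\mathrm{vec}\,X$ denotes the partial Jacobian matrix of this function, i.e. the matrix $J$ such that the differential satisfies $\mathrm{d}\,\mathrm{vec}\,P = J\,\mathrm{d}\,\mathrm{vec}\,X$ when the other three arguments are held fixed. *)

(* Defs.v *)
From HB Require Import structures.
From mathcomp Require Import all_boot all_order all_algebra.
From mathcomp Require Import complex.
From mathcomp Require Import boolp classical_sets reals topology normedtype derive.
From mathcomp Require character.

Set Implicit Arguments.
Unset Strict Implicit.
Unset Printing Implicit Defensive.

Import Order.TTheory GRing.Theory Num.Theory.
Import numFieldNormedType.Exports.

Local Open Scope classical_set_scope.
Local Open Scope ring_scope.

Notation "A ⊗ B" := (character.tprod A B)
  (at level 40, left associativity) : ring_scope.

Section Vectorization.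
Context {F : fieldType}.

(* [mxvec] stacks rows into a row vector; transposing before and after stacks
   columns into a column vector. *)
Definition vec p q (X : 'M[F]_(p, q)) : 'cV[F]_(q * p) := (mxvec X^T)^T.

Definition commutation_mx p q : 'M[F]_(p * q, q * p) := (lin_mx (@trmx F q p))^T.

Lemma commutation_mx_vec p q (X : 'M[F]_(p, q)) :
  commutation_mx p q *m vec X = vec X^T.
Proof. by rewrite /vec -trmx_mul mul_vec_lin. Qed.

Lemma commutation_mx_uniq p q (V : 'M[F]_(p * q, q * p)) :
  (forall X : 'M[F]_(p, q), V *m vec X = vec X^T) -> V = commutation_mx p q.
Proof.
move=> hV; apply/trmx_inj/row_matrixP => i; rewrite !rowE.
apply: trmx_inj; rewrite !trmx_mul !trmxK.
have -> : (delta_mx 0 i : 'rV[F]_(q * p))^T = vec (vec_mx (delta_mx 0 i))^T.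
  by rewrite /vec trmxK vec_mxK.
by rewrite hV commutation_mx_vec.
Qed.

Lemma val_mxvec_index p q (i : 'I_p) (j : 'I_q) :
  mxvec_index i j = (i * q + j)%N :> nat.
Proof.
have idx (T1 T2 : eqType) (s : seq T1) (t : seq T2) x y : x \in s -> y \in t ->
    index (x, y) [seq (a, b) | a <- s, b <- t] =
    (index x s * size t + index y t)%N.
  elim: s => //= a s IH; rewrite inE index_cat => xs yt.
  case: (eqVneq a x) => [->|ax].
    by rewrite map_f // index_map // => b c [].
  rewrite ifF; last first.
    by apply/negP => /mapP [b _ [/esym/eqP]]; rewrite (negbTE ax).
  by case/orP: xs => [/eqP xa|xs]; rewrite ?xa ?eqxx // in ax *;
     rewrite IH // size_map mulSn addnA.
have <- : index (i, j) (enum {: 'I_p * 'I_q}) = mxvec_index i j.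
  by rewrite -[X in index X _](nth_enum_rank (i, j)) index_uniq ?enum_uniq // -cardE.
have -> : enum {: 'I_p * 'I_q} = [seq (a, b) | a <- enum 'I_p, b <- enum 'I_q].
  by rewrite enumT unlock.
by rewrite idx ?mem_enum // !index_enum_ord size_enum_ord.
Qed.

Lemma vecE p q (X : 'M[F]_(p, q)) i j : vec X (mxvec_index j i) 0 = X i j.
Proof. by rewrite !mxE mxvecE mxE. Qed.

Lemma tprod_mxvec_index p q r s (A : 'M[F]_(p, q)) (B : 'M[F]_(r, s)) i j k l :
  (A ⊗ B) (mxvec_index i k) (mxvec_index j l) = A i j * B k l.
Proof.
have trow_val (n1 : nat) : forall (a : 'rV[F]_n1) k (j : 'I_n1) (l : 'I_s) (c : 'I_(n1 * s)),
    c = (j * s + l)%N :> nat -> character.trow a B k c = a 0 j * B k l.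
  elim: n1 => [|n1 IH] a k0 j0 l0 c; first by case: j0.
  move=> hc /=; rewrite mxE; case: splitP => c' hc'.
    have j00 : j0 = 0 :> nat.
      by case: j0 hc => -[|j0] // ?; rewrite hc' mulSn -addnA /= => h;
         have := ltn_ord c'; rewrite h ltnNge leq_addr.
    rewrite !mxE; congr (a _ _ * B _ _); first exact/val_inj.
    by apply/val_inj; rewrite /= -hc' hc j00.
  have [j' hj'] : exists j' : 'I_n1, j0 = lift ord0 j'.
    case: (unliftP ord0 j0) => [j' ->|j00]; first by exists j'.
    by move: hc (ltn_ord l0); rewrite j00 hc' mul0n add0n => <-; rewrite ltnNge leq_addr.
  rewrite (IH _ _ j' l0); last first.
    by apply/eqP; rewrite -(eqn_add2l s) -hc' hc hj' /= /bump /= mulSn addnA.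
  by rewrite mxE hj'; congr (a _ _ * _); apply: val_inj.
move: (val_mxvec_index i k) (val_mxvec_index j l).
move: (mxvec_index i k) (mxvec_index j l) => e c.
elim: p A i e => [|p IH] A i e; first by case: i.
move=> he hc /=; rewrite mxE; case: splitP => e' he'.
  have i0 : i = 0 :> nat.
    by case: i he => -[|i] // ?; rewrite he' mulSn -addnA /= => h;
       have := ltn_ord e'; rewrite h ltnNge leq_addr.
  rewrite (trow_val _ _ _ j l) // !mxE; congr (A _ _ * B _ _); first exact/val_inj.
  by apply/val_inj; rewrite /= -he' he i0.
have [i' hi'] : exists i' : 'I_p, i = lift ord0 i'.
  case: (unliftP ord0 i) => [i' ->|i0]; first by exists i'.
  by move: he (ltn_ord k); rewrite i0 he' mul0n add0n => <-; rewrite ltnNge leq_addr.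
rewrite (IH _ i') //; last first.
  by apply/eqP; rewrite -(eqn_add2l r) -he' he hi' /= /bump /= mulSn addnA.
by rewrite mxE hi'; congr (A _ _ * _); apply: val_inj.
Qed.

Lemma vec_mulmx p q r s (X : 'M[F]_(p, q)) (Y : 'M[F]_(q, r)) (W : 'M[F]_(r, s)) :
  vec (X *m Y *m W) = (W^T ⊗ X) *m vec Y.
Proof.
apply/colP => k; case/mxvec_indexP: k => j i; rewrite vecE !mxE.
rewrite (reindex _ (curry_mxvec_bij _ _)) /=.
rewrite [RHS](eq_bigr (fun ab => (W^T ⊗ X) (mxvec_index j i) (mxvec_index ab.1 ab.2)
  * vec Y (mxvec_index ab.1 ab.2) 0)); last by case.
rewrite -(pair_bigA _ (fun a b => (W^T ⊗ X) (mxvec_index j i) (mxvec_index a b)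
  * vec Y (mxvec_index a b) 0)) /=.
apply: eq_bigr => a _; rewrite mxE mulr_suml; apply: eq_bigr => b _.
by rewrite tprod_mxvec_index vecE mxE mulrC mulrA.
Qed.

End Vectorization.

Section Riccati.
Context {F : realType}.

Definition psd n (M : 'M[F]_n) : Prop :=
  M^T = M /\ forall x : 'cV[F]_n, 0 <= (x^T *m M *m x) 0 0.

(* Eigenvalues are complex; the [sup] is a maximum, the spectrum being finite. *)
Definition spectral_radius n (M : 'M[F]_n) : F :=
  sup [set r | exists2 z : F[i],
    eigenvalue (map_mx (real_complex F) M) z & r = ComplexField.Normc.normc z].

Context {n m : nat}.
Implicit Types (A Q P : 'M[F]_n) (B : 'M[F]_(n, m)) (R : 'M[F]_m).

(* [invmx M] is [M] itself when [M] is singular, so the existence of the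
   inverse is part of the equation. *)
Definition DARE A B Q R P : Prop :=
  R + B^T *m P *m B \in unitmx /\
  P = A^T *m P *m A
      - A^T *m P *m B *m invmx (R + B^T *m P *m B) *m B^T *m P *m A + Q.

Definition lqr_gain A B R P : 'M[F]_(m, n) :=
  - (invmx (R + B^T *m P *m B) *m B^T *m P *m A).

Definition stabilizing_solution A B Q R P : Prop :=
  DARE A B Q R P /\ spectral_radius (A + B *m lqr_gain A B R P) <= 1.

Definition M3 B R P : 'M[F]_m := R + B^T *m P *m B.
Definition M2 B R P : 'M[F]_m := invmx (M3 B R P).
Definition M1 B R P : 'M[F]_n := P - P *m B *m M2 B R P *m B^T *m P.

Definition Z1 A B R P : 'M[F]_(n * n) :=
  1%:M - (A^T ⊗ A^T) *m
    (1%:M - (P *m B *m M2 B R P *m B^T) ⊗ 1%:M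
          - 1%:M ⊗ (P *m B *m M2 B R P *m B^T)
          + ((P *m B) ⊗ (P *m B)) *m (M2 B R P ⊗ M2 B R P) *m (B^T ⊗ B^T)).

Definition Z2 A B R P : 'M[F]_(n * n) :=
  (commutation_mx n n + 1%:M) *m (1%:M ⊗ (A^T *m M1 B R P)).

Definition Z3 A B R P : 'M[F]_(n * n, m * n) :=
  (A^T ⊗ A^T) *m
    (((P *m B) ⊗ (P *m B)) *m (M2 B R P ⊗ M2 B R P)
       *m (1%:M + commutation_mx m m) *m (1%:M ⊗ (B^T *m P))
     - (1%:M + commutation_mx n n) *m ((P *m B *m M2 B R P) ⊗ P)).

Definition Z4 : 'M[F]_(n * n) := 1%:M.

Definition Z5 A B R P : 'M[F]_(n * n, m * m) :=
  (A^T ⊗ A^T) *m ((P *m B) ⊗ (P *m B)) *m (M2 B R P ⊗ M2 B R P).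

End Riccati.

(* Near [x0], [g x] is the only solution of [E x y] with [y] near [y0]. *)
Definition implicit_function (U V : topologicalType) (E : U -> V -> Prop)
    (x0 : U) (y0 : V) (g : U -> V) : Prop :=
  [/\ g x0 = y0, {for x0, continuous g} &
    exists S W, [/\ nbhs x0 S, nbhs y0 W &
      forall x, S x -> W (g x) /\ forall y, W y -> (E x y <-> y = g x)]].

(* The differential satisfies [d (vec f) = J d (vec X)]. *)
Definition has_jacobian (F : realType) p q r s
    (f : 'M[F]_(p, q) -> 'M[F]_(r, s)) (X : 'M[F]_(p, q))
    (J : 'M[F]_(s * r, q * p)) : Prop :=
  differentiable f X /\ forall dX, vec ('d f X dX) = J *m vec dX.

(* Main.v *)
Require Import Defs.
From HB Require Import structures.
From mathcomp Require Import all_boot all_order all_algebra.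
From mathcomp Require Import boolp classical_sets reals topology normedtype derive.
From mathcomp Require Import functions interval_inference prodnormedzmodule landau sequences.
From mathcomp Require Import ring lra.

(* The DARE reads [P = Psi(D, P)] with data [D = (A, B, Q, R)]. By the rule
   [vec (X Y W) = (W^T ⊗ X) vec Y], the matrix of [dP - dPsi(0, dP)] is [Z1], so
   [L = Z1^-1] (through [vec]) makes the simplified Newton map
   [Phi(D, P) = P - L (P - Psi(D, P))] have the same fixed points as [Psi(D, -)]
   and a derivative that does not see [dP].
   [Phi] is strictly differentiable, hence a contraction in [P] uniformly for [D]
   near the given data; Banach's theorem gives the implicit function, and strict
   differentiability forces any implicit function to have derivative
   [L o dPsi(-, 0)], whose matrices are the [Z1^-1 Zi]. *)

Set Implicit Arguments.
Unset Strict Implicit.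
Unset Printing Implicit Defensive.

Import Order.TTheory GRing.Theory Num.Theory.
Import numFieldNormedType.Exports.

Local Open Scope classical_set_scope.
Local Open Scope ring_scope.

(* MathComp-Analysis has the complete and the normed structures on matrices but
   not their join. *)
HB.instance Definition _ (F : realType) (m n : nat) := Complete.on 'M[F]_(m, n).

(** * Bounded linear maps between normed spaces *)

Section BoundedLinear.
Context {F : realType}.
Implicit Types U V W : normedModType F.

(** Stated for bare functions, so that differentials built as lambda terms need no bundled linear
    structure. *)
Definition bounded_linear V W (f : V -> W) : Prop :=
  linear f /\ exists2 k, 0 <= k & forall h, `|f h| <= k * `|h|.

Lemma linear_eqD V W (f : V -> W) : linear f -> {morph f : x y / x + y}.
Proof. by move=> fl x y; rewrite -[x]scale1r fl !scale1r. Qed.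

Lemma linear_eq0 V W (f : V -> W) : linear f -> f 0 = 0.
Proof. by move=> fl; apply: (addrI (f 0)); rewrite -linear_eqD // !addr0. Qed.

Lemma linear_eqB V W (f : V -> W) : linear f -> {morph f : x y / x - y}.
Proof. by move=> fl x y; rewrite addrC -scaleN1r fl scaleN1r addrC. Qed.

Lemma bounded_linear_comp U V W (f : V -> W) (g : U -> V) :
  bounded_linear f -> bounded_linear g -> bounded_linear (f \o g).
Proof.
move=> [fl [k k0 fk]] [gl [l l0 gk]]; split; first by move=> a u v /=; rewrite gl fl.
exists (k * l); first exact: mulr_ge0.
by move=> h; rewrite (le_trans (fk _)) // -mulrA ler_wpM2l.
Qed.

Lemma bounded_linearD V W (f g : V -> W) :
  bounded_linear f -> bounded_linear g -> bounded_linear (fun h => f h + g h).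
Proof.
move=> [fl [k k0 fk]] [gl [l l0 gk]]; split.
  by move=> a u v; rewrite fl gl scalerDr addrACA.
exists (k + l); first exact: addr_ge0.
by move=> h; rewrite (le_trans (ler_normD _ _)) // mulrDl lerD.
Qed.

Lemma bounded_linearN V W (f : V -> W) :
  bounded_linear f -> bounded_linear (fun h => - f h).
Proof.
move=> [fl [k k0 fk]]; split; first by move=> a u v; rewrite fl opprD scalerN.
by exists k => // h; rewrite normrN.
Qed.

Lemma bounded_linear_id V : bounded_linear (fun x : V => x).
Proof. by split=> //; exists 1 => // h; rewrite mul1r. Qed.

Lemma bounded_linear_fst U V W (f : U -> V * W) :
  bounded_linear f -> bounded_linear (fun x => (f x).1).
Proof.
move=> [fl [k k0 fk]]; split; first by move=> a u v; rewrite fl.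
by exists k => // h; rewrite (le_trans _ (fk h)) // prod_normE le_max lexx.
Qed.

Lemma bounded_linear_snd U V W (f : U -> V * W) :
  bounded_linear f -> bounded_linear (fun x => (f x).2).
Proof.
move=> [fl [k k0 fk]]; split; first by move=> a u v; rewrite fl.
by exists k => // h; rewrite (le_trans _ (fk h)) // prod_normE le_max lexx orbT.
Qed.

Lemma bounded_linear_pairl V W : bounded_linear (fun x : V => (x, 0 : W)).
Proof.
split; first by move=> a u v; congr pair; rewrite /= scaler0 addr0.
exists 1 => // h; rewrite mul1r prod_normE /= normr0.
by rewrite max_l.
Qed.

Lemma continuous_bounded_linear V W (f : V -> W) : bounded_linear f -> continuous f.
Proof.
move=> [fl [k k0 fk]] x; apply/cvgrPdist_lt => e e0.
have k1 : 0 < k + 1 by rewrite ltr_wpDl.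
near=> y; rewrite -linear_eqB //; apply: le_lt_trans (fk _) _.
apply: (@le_lt_trans _ _ ((k + 1) * `|x - y|)).
  by rewrite ler_wpM2r // lerDl.
rewrite -ltr_pdivlMl //; near: y.
by apply: cvgr_dist_lt => //; rewrite mulr_gt0 // invr_gt0.
Unshelve. all: by end_near. Qed.

(** The estimate is the little-o expansion of [f] at [a]; a continuous linear map with this
    expansion is the differential, by uniqueness. *)
Lemma is_diff_bounded_linear V W (f df : V -> W) (a : V) : bounded_linear df ->
  (forall e, 0 < e -> \forall x \near a, `|f x - f a - df (x - a)| <= e * `|x - a|) ->
  is_diff a f df.
Proof.
move=> dfb fP; have [dfl _] := dfb.
pose dfM := GRing.isLinear.Build _ _ _ _ _ dfl.
pose dfL : {linear V -> W} := HB.pack df dfM.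
have dfc : continuous dfL by exact: continuous_bounded_linear.
have dfE : f \o shift a = cst (f a) + dfL +o_ 0 id.
  apply/eqaddoP => e e0; have := fP e e0.
  rewrite (near_shift 0); apply: filterS => x /=.
  by rewrite subr0 addrK /= !fctE opprD addrA.
have := diff_unique dfc dfE => dE.
by apply: DiffDef => //; apply/diff_locallyP; rewrite dE.
Qed.

End BoundedLinear.

(** * The maximum norm on matrices *)

Section MatrixNorm.
Context {F : realType}.

Lemma norm_mx_coord p q (X : 'M[F]_(p, q)) i j : `|X i j| <= `|X|.
Proof.
rewrite [leRHS]/Num.norm /= mx_normrE.
exact: (le_bigmax _ (fun ij : 'I_p * 'I_q => `|X ij.1 ij.2|) (i, j)).
Qed.

Lemma norm_mx_le p q (X : 'M[F]_(p, q)) k : 0 <= k ->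
  (forall i j, `|X i j| <= k) -> `|X| <= k.
Proof.
by move=> k0 Xk; rewrite [leLHS]/Num.norm /= mx_normrE bigmax_le.
Qed.

(** An entry of the product is a sum of [q] terms, hence the factor [q] for the maximum norm. *)
Lemma norm_mulmx p q r (X : 'M[F]_(p, q)) (Y : 'M[F]_(q, r)) :
  `|X *m Y| <= q%:R * (`|X| * `|Y|).
Proof.
apply: norm_mx_le => [|i j]; first by rewrite !mulr_ge0.
rewrite mxE (le_trans (ler_norm_sum _ _ _)) //.
rewrite -[X in _ <= X%:R * _]card_ord mulr_natl -sumr_const ler_sum // => k _.
by rewrite normrM ler_pM // norm_mx_coord.
Qed.

(** Finite dimension: expand the argument in the basis [delta_mx i j] and sum the norms of the
    images. *)
Lemma bounded_linear_mx p q (W : normedModType F) (f : 'M[F]_(p, q) -> W) :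
  linear f -> bounded_linear f.
Proof.
move=> fl; split=> //.
pose fM := GRing.isLinear.Build _ _ _ _ _ fl.
pose fL : {linear 'M[F]_(p, q) -> W} := HB.pack f fM.
exists (\sum_i \sum_j `|f (delta_mx i j)|); first by do 2!apply: sumr_ge0 => ? _.
move=> h; rewrite [in leLHS](matrix_sum_delta h) -[f _]/(fL _) linear_sum.
rewrite (le_trans (ler_norm_sum _ _ _)) // mulr_suml ler_sum // => i _.
rewrite linear_sum (le_trans (ler_norm_sum _ _ _)) // mulr_suml ler_sum // => j _.
by rewrite linearZ normrZ mulrC ler_wpM2l // norm_mx_coord.
Qed.

End MatrixNorm.

(** * Big-O and little-o estimates relative to a scalar gauge *)

Section Domination.
Context {F : realType} {T : Type} (G : set_system T) {FG : Filter G}.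
Implicit Types (W : normedModType F) (phi : T -> F).

(** Big-O along [G], with little-o next. The gauge [phi] is explicit so that gauges multiply under
    matrix products. *)
Definition dominated phi W (u : T -> W) : Prop :=
  exists2 k, 0 < k & \forall p \near G, `|u p| <= k * phi p.

Definition negligible phi W (u : T -> W) : Prop :=
  forall e, 0 < e -> \forall p \near G, `|u p| <= e * phi p.

Lemma negligible_dominated phi W (u : T -> W) : negligible phi u -> dominated phi u.
Proof. by move=> /(_ 1 ltr01) u1; exists 1. Qed.

Lemma negligibleD phi W (u v : T -> W) :
  negligible phi u -> negligible phi v -> negligible phi (fun p => u p + v p).
Proof.
move=> un vn e e0; have e20 : 0 < e / 2 by rewrite divr_gt0.
near=> p; rewrite (le_trans (ler_normD _ _)) // (splitr e) mulrDl lerD //.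
  by near: p; exact: un.
by near: p; exact: vn.
Unshelve. all: by end_near. Qed.

Lemma negligibleN phi W (u : T -> W) :
  negligible phi u -> negligible phi (fun p => - u p).
Proof. by move=> un e /un; apply: filterS => p; rewrite normrN. Qed.

Lemma dominatedD phi W (u v : T -> W) :
  dominated phi u -> dominated phi v -> dominated phi (fun p => u p + v p).
Proof.
move=> [k k0 uk] [l l0 vl]; exists (k + l); first exact: addr_gt0.
near=> p; rewrite (le_trans (ler_normD _ _)) // mulrDl lerD //.
  by near: p.
by near: p.
Unshelve. all: by end_near. Qed.

Lemma dominated_eq phi W (u v : T -> W) :
  (\forall p \near G, u p = v p) -> dominated phi u -> dominated phi v.
Proof.
move=> uv [k k0 uk]; exists k => //; near=> p.
have <- : u p = v p by near: p.
by near: p.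
Unshelve. all: by end_near. Qed.

Lemma negligible_eq phi W (u v : T -> W) :
  (\forall p \near G, u p = v p) -> negligible phi u -> negligible phi v.
Proof.
move=> uv un e e0; near=> p.
have <- : u p = v p by near: p.
by near: p; exact: un.
Unshelve. all: by end_near. Qed.

Lemma mulmx_dominated_negligible phi psi p q r
    (u : T -> 'M[F]_(p, q)) (v : T -> 'M[F]_(q, r)) :
  dominated phi u -> negligible psi v ->
  negligible (fun t => phi t * psi t) (fun t => u t *m v t).
Proof.
(* [q%:R * k] is the constant of the product estimate; the [+ 1] keeps [c] positive when [q = 0]. *)
move=> [k k0 uk] vn e e0; pose c : F := q%:R * k + 1.
have c0 : 0 < c by rewrite ltr_wpDl // mulr_ge0 // ltW.
have ec0 : 0 < e / c by rewrite divr_gt0.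
near=> t; rewrite (le_trans (norm_mulmx _ _)) //.
have ukt : `|u t| <= k * phi t by near: t.
have vnt : `|v t| <= e / c * psi t by near: t; exact: vn.
apply: (@le_trans _ _ (q%:R * ((k * phi t) * (e / c * psi t)))).
  by rewrite ler_wpM2l // ler_pM.
(* Gauges carry no sign hypothesis; each is nonnegative at [t] because a positive multiple of it
   bounds a norm. *)
have phi0 : 0 <= phi t by rewrite -(pmulr_rge0 _ k0) (le_trans _ ukt).
have psi0 : 0 <= psi t by rewrite -(pmulr_rge0 _ ec0) (le_trans _ vnt).
have -> : q%:R * (k * phi t * (e / c * psi t)) =
    (q%:R * k / c) * (e * (phi t * psi t)) by ring.
by rewrite ler_piMl ?mulr_ge0 ?(ltW e0) // ler_pdivrMr // mul1r /c lerDl.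
Unshelve. all: by end_near. Qed.

Lemma mulmx_negligible_dominated phi psi p q r
    (u : T -> 'M[F]_(p, q)) (v : T -> 'M[F]_(q, r)) :
  negligible phi u -> dominated psi v ->
  negligible (fun t => phi t * psi t) (fun t => u t *m v t).
Proof.
move=> un [k k0 vk] e e0; pose c : F := q%:R * k + 1.
have c0 : 0 < c by rewrite ltr_wpDl // mulr_ge0 // ltW.
have ec0 : 0 < e / c by rewrite divr_gt0.
near=> t; rewrite (le_trans (norm_mulmx _ _)) //.
have vkt : `|v t| <= k * psi t by near: t.
have unt : `|u t| <= e / c * phi t by near: t; exact: un.
apply: (@le_trans _ _ (q%:R * ((e / c * phi t) * (k * psi t)))).
  by rewrite ler_wpM2l // ler_pM.
have psi0 : 0 <= psi t by rewrite -(pmulr_rge0 _ k0) (le_trans _ vkt).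
have phi0 : 0 <= phi t by rewrite -(pmulr_rge0 _ ec0) (le_trans _ unt).
have -> : q%:R * (e / c * phi t * (k * psi t)) =
    (q%:R * k / c) * (e * (phi t * psi t)) by ring.
by rewrite ler_piMl ?mulr_ge0 ?(ltW e0) // ler_pdivrMr // mul1r /c lerDl.
Unshelve. all: by end_near. Qed.

Lemma mulmx_dominated phi psi p q r
    (u : T -> 'M[F]_(p, q)) (v : T -> 'M[F]_(q, r)) :
  dominated phi u -> dominated psi v ->
  dominated (fun t => phi t * psi t) (fun t => u t *m v t).
Proof.
move=> [k k0 uk] [l l0 vl]; exists ((q%:R + 1) * (k * l)).
  by rewrite !mulr_gt0 // ltr_wpDl.
near=> t; rewrite (le_trans (norm_mulmx _ _)) //.
have ukt : `|u t| <= k * phi t by near: t.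
have vlt : `|v t| <= l * psi t by near: t.
rewrite -mulrA ler_pM ?mulr_ge0 ?lerDl //.
by rewrite mulrACA ler_pM.
Unshelve. all: by end_near. Qed.

End Domination.

(** * Strict differentiability and its basic rules *)

Section StrictDifferential.
Context {F : realType}.
Implicit Types U V W : normedModType F.

(* Both points vary, unlike in [differentiable]: when [df] ignores a variable,
   [f] is a contraction in that variable near [a]. *)
Definition strict_diff V W (f df : V -> W) (a : V) : Prop :=
  bounded_linear df /\
  negligible (nbhs (a, a)) (fun p => `|p.1 - p.2|)
    (fun p => f p.1 - f p.2 - df (p.1 - p.2)).

Lemma near_fst V (a : V) (P : set V) :
  (\forall x \near a, P x) -> \forall p \near (a, a), P p.1.
Proof. exact: (@cvg_fst _ _ (nbhs a) (nbhs a)). Qed.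

Lemma near_snd V (a : V) (P : set V) :
  (\forall x \near a, P x) -> \forall p \near (a, a), P p.2.
Proof. exact: (@cvg_snd _ _ (nbhs a) (nbhs a)). Qed.

Lemma strict_diff_eq V W (f df dg : V -> W) a :
  df =1 dg -> strict_diff f df a -> strict_diff f dg a.
Proof. by move=> /funext ->. Qed.

Lemma strict_diff_linear V W (f : V -> W) a : bounded_linear f -> strict_diff f f a.
Proof.
move=> fb; split=> // e e0; apply: nearW => p.
by rewrite (linear_eqB fb.1) subrr normr0 mulr_ge0 // ltW.
Qed.

Lemma strict_diffD V W (f g df dg : V -> W) a :
  strict_diff f df a -> strict_diff g dg a ->
  strict_diff (fun x => f x + g x) (fun h => df h + dg h) a.
Proof.
move=> [dfb fn] [dgb gn]; split; first exact: bounded_linearD.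
apply: negligible_eq (negligibleD fn gn); apply: nearW => p.
by rewrite !opprD addrACA (addrACA (f p.1)).
Qed.

Lemma strict_diffN V W (f df : V -> W) a :
  strict_diff f df a -> strict_diff (fun x => - f x) (fun h => - df h) a.
Proof.
move=> [dfb fn]; split; first exact: bounded_linearN.
by apply: negligible_eq (negligibleN fn); apply: nearW => p; rewrite !opprD.
Qed.

Lemma strict_diff_comp_linear U V W (l : V -> W) (f df : U -> V) a :
  bounded_linear l -> strict_diff f df a ->
  strict_diff (fun x => l (f x)) (fun h => l (df h)) a.
Proof.
move=> lb [dfb fn]; split; first exact: bounded_linear_comp.
have [ll [k k0 lk]] := lb.
have k1 : 0 < k + 1 by rewrite ltr_wpDl.
move=> e e0; near=> p; rewrite -!(linear_eqB ll) (le_trans (lk _)) //.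
apply: (@le_trans _ _ ((k + 1) * (e / (k + 1) * `|p.1 - p.2|))).
  rewrite ler_pM ?lerDl //; near: p; apply: fn.
  by rewrite divr_gt0.
by rewrite mulrA mulrCA divff ?mulr1 // gt_eqF.
Unshelve. all: by end_near. Qed.

Lemma bounded_linear_dominated V W (df : V -> W) (a : V) : bounded_linear df ->
  dominated (nbhs (a, a)) (fun p => `|p.1 - p.2|) (fun p => df (p.1 - p.2)).
Proof.
move=> [_ [k k0 dfk]]; exists (k + 1); first by rewrite ltr_wpDl.
by apply: nearW => p; rewrite (le_trans (dfk _)) // ler_wpM2r ?lerDl.
Qed.

Lemma strict_diff_dominated V W (f df : V -> W) a : strict_diff f df a ->
  dominated (nbhs (a, a)) (fun p => `|p.1 - p.2|) (fun p => f p.1 - f p.2).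
Proof.
move=> [dfb fn].
apply: dominated_eq (dominatedD (negligible_dominated fn)
  (bounded_linear_dominated a dfb)).
by apply: nearW => p; rewrite subrK.
Qed.

Lemma strict_diff_continuous V W (f df : V -> W) a : strict_diff f df a ->
  {for a, continuous f}.
Proof.
move=> /strict_diff_dominated [k k0 fk].
have : \forall x \near a, `|f a - f x| <= k * `|a - x|.
  (* Freezing the first point at [a] turns the two-point bound into a bound at [a]. *)
  have : (a, x) @[x --> a] --> (a, a) by apply: cvg_pair; [exact: cvg_cst|exact: cvg_id].
  by move=> /(_ _ fk).
move=> fk'; apply/cvgrPdist_lt => e e0; near=> x.
apply: (@le_lt_trans _ _ (k * `|a - x|)); first by near: x.
rewrite -ltr_pdivlMl //; near: x.
by apply: cvgr_dist_lt => //; rewrite mulr_gt0 // invr_gt0.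
Unshelve. all: by end_near. Qed.

Lemma continuous_dominated1 T V (G : set_system T) (u : T -> V) (w : V) {FG : Filter G} :
  u t @[t --> G] --> w -> dominated G (fun=> 1) u.
Proof.
move=> uw; exists (`|w| + 1); first by rewrite ltr_wpDl.
near=> t; rewrite mulr1.
have : `|w - u t| < 1 by near: t; exact: cvgr_dist_lt.
have := ler_normB w (w - u t); rewrite subKr => /le_trans H /ltW ?.
by apply: H; rewrite lerD2l.
Unshelve. all: by end_near. Qed.

Lemma continuous_negligible1 T V (G : set_system T) (u : T -> V) (w : V) {FG : Filter G} :
  u t @[t --> G] --> w -> negligible G (fun=> 1) (fun t => u t - w).
Proof.
move=> uw e e0; near=> t; rewrite mulr1 distrC ltW //; near: t.
exact: cvgr_dist_lt.
Unshelve. all: by end_near. Qed.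

End StrictDifferential.

(** * Product and inverse rules for matrix-valued maps *)

Section MatrixStrictDifferential.
Context {F : realType} {V : normedModType F}.

(** This and the next two drop the gauge 1 that a bounded or convergent factor contributes to a
    product. *)
Lemma negligible_mulr1 T (G : set_system T) (W : normedModType F) phi (u : T -> W) :
  negligible G (fun t => phi t * 1) u -> negligible G phi u.
Proof. by under eq_fun do rewrite mulr1. Qed.

Lemma negligible_mul1r T (G : set_system T) (W : normedModType F) phi (u : T -> W) :
  negligible G (fun t => 1 * phi t) u -> negligible G phi u.
Proof. by under eq_fun do rewrite mul1r. Qed.

Lemma dominated_mulr1 T (G : set_system T) (W : normedModType F) phi (u : T -> W) :
  dominated G (fun t => phi t * 1) u -> dominated G phi u.
Proof. by under eq_fun do rewrite mulr1. Qed.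

Lemma continuous_near_fst (W : topologicalType) (f : V -> W) a :
  {for a, continuous f} -> f p.1 @[p --> (a, a)] --> f a.
Proof. by move=> fc P /fc; exact: near_fst. Qed.

Lemma continuous_near_snd (W : topologicalType) (f : V -> W) a :
  {for a, continuous f} -> f p.2 @[p --> (a, a)] --> f a.
Proof. by move=> fc P /fc; exact: near_snd. Qed.

(** With f1, f2, g1, g2 the values at the two points, the error is (f1 - f2 - df) g1 + df (g1 - g a)
    + f2 (g1 - g2 - dg) + (f2 - f a) dg, and each summand is negligible. *)
Lemma strict_diff_mulmx p q r (f df : V -> 'M[F]_(p, q)) (g dg : V -> 'M[F]_(q, r)) a :
  strict_diff f df a -> strict_diff g dg a ->
  strict_diff (fun x => f x *m g x) (fun h => df h *m g a + f a *m dg h) a.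
Proof.
move=> fD gD; have [dfb fn] := fD; have [dgb gn] := gD.
have fc := strict_diff_continuous fD; have gc := strict_diff_continuous gD.
split.
  apply: bounded_linearD.
    apply: (bounded_linear_comp (f := mulmxr (g a)) _ dfb).
    apply: bounded_linear_mx => k u v.
    by rewrite /= mulmxDl scalemxAl.
  apply: (bounded_linear_comp (f := mulmx (f a)) _ dgb).
  apply: bounded_linear_mx => k u v.
  by rewrite mulmxDr scalemxAr.
have g1 := continuous_near_fst gc; have f2 := continuous_near_snd fc.
pose proof (negligible_mulr1 (mulmx_negligible_dominated fn (continuous_dominated1 g1))) as n1.
pose proof (negligible_mulr1 (mulmx_dominated_negligible
  (bounded_linear_dominated a dfb) (continuous_negligible1 g1))) as n2.
pose proof (negligible_mul1r (mulmx_dominated_negligible (continuous_dominated1 f2) gn)) as n3.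
pose proof (negligible_mul1r (mulmx_negligible_dominated
  (continuous_negligible1 f2) (bounded_linear_dominated a dgb))) as n4.
pose proof (negligibleD (negligibleD n1 n2) (negligibleD n3 n4)) as n5.
apply: negligible_eq n5.
apply: nearW => t /=; rewrite !mulmxBl !mulmxBr.
by rewrite !addrA !subrK [_ - _ - df _ *m _]addrAC subrK opprD addrA [X in X - _ = _]addrAC.
Qed.

(** For [M] close to [M0], right multiplication by [(M0 - M) *m invmx M0] at least halves norms. So
    [M] kills no nonzero row, and the norm of [invmx M] is at most that of [invmx M0] plus half of
    itself. *)
Lemma unitmx_near_bounded p (M0 : 'M[F]_p) : M0 \in unitmx ->
  \forall M \near M0, M \in unitmx /\ `|invmx M| <= 2 * `|invmx M0|.
Proof.
(* Each of the two products in [small] costs a factor [p]; the 2 yields the halving, the [+ 1]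
   positivity. *)
move=> u0; pose c : F := p%:R * (p%:R * `|invmx M0|) * 2 + 1.
have c1 : 0 < c by rewrite ltr_wpDl // !mulr_ge0.
have small q (X : 'M[F]_(q, p)) M : `|M0 - M| < c^-1 ->
    `|X *m (M0 - M) *m invmx M0| <= `|X| / 2.
  move=> Mc; rewrite (le_trans (norm_mulmx _ _)) //.
  apply: (@le_trans _ _ (p%:R * (p%:R * (`|X| * c^-1) * `|invmx M0|))).
    rewrite ler_wpM2l // ler_wpM2r // (le_trans (norm_mulmx _ _)) //.
    by rewrite ler_wpM2l // ler_wpM2l // ltW.
  have -> : p%:R * (p%:R * (`|X| * c^-1) * `|invmx M0|) =
     `|X| * ((c - 1) / 2 * c^-1) by rewrite {1}/c addrK mulfK ?pnatr_eq0 //; ring.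
  rewrite ler_wpM2l // ler_pdivrMr //.
  by have : 0 < c by []; lra.
near=> M; have Mc : `|M0 - M| < c^-1.
  by near: M; apply: cvgr_dist_lt => //; rewrite invr_gt0.
have uM : M \in unitmx.
  rewrite -row_free_unit; apply: inj_row_free => v vM.
  have vE : v *m (M0 - M) *m invmx M0 = v.
    by rewrite mulmxBr vM subr0 mulmxK.
  have := small _ v M Mc; rewrite vE => vh.
  by apply/normr0_eq0/eqP; rewrite eq_le normr_ge0 andbT; lra.
split=> //.
have iE : invmx M = invmx M0 + invmx M *m (M0 - M) *m invmx M0.
  by rewrite mulmxBr mulVmx // mulmxBl mulmxK // mul1mx addrC subrK.
have := small _ (invmx M) M Mc; have := ler_normD (invmx M0) (invmx M *m (M0 - M) *m invmx M0).
rewrite -iE; lra.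
Unshelve. all: by end_near. Qed.

Lemma unitmx_near p (M0 : 'M[F]_p) : M0 \in unitmx -> \forall M \near M0, M \in unitmx.
Proof. by move=> /unitmx_near_bounded; apply: filterS => M []. Qed.

(** The difference of the inverses is [invmx M *m ((M - M0) *m invmx M0)], and [invmx M] stays
    bounded near [M0]. *)
Lemma invmx_continuous p (M0 : 'M[F]_p) : M0 \in unitmx ->
  {for M0, continuous (@invmx F p)}.
Proof.
move=> u0; have nM := unitmx_near_bounded u0.
have d : dominated (nbhs M0) (fun=> 1) (@invmx F p).
  exists (2 * `|invmx M0| + 1); first by rewrite ltr_wpDl // mulr_ge0.
  near=> M; rewrite mulr1.
  apply: (@le_trans _ _ (2 * `|invmx M0|)); last by rewrite lerDl.
  by have [] : M \in unitmx /\ `|invmx M| <= 2 * `|invmx M0| by near: M.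
have nid : negligible (nbhs M0) (fun=> 1) (fun M => (M - M0) *m invmx M0).
  apply: negligible_mulr1; apply: mulmx_negligible_dominated.
    by apply: continuous_negligible1; exact: cvg_id.
  by apply: continuous_dominated1; exact: cvg_cst.
have := negligible_mulr1 (mulmx_dominated_negligible d nid) => n.
apply/(@cvgrPdist_le _ _ _ (nbhs M0)) => e e0; near=> M.
have -> : invmx M0 - invmx M = invmx M *m ((M - M0) *m invmx M0).
  have [uM _] : M \in unitmx /\ `|invmx M| <= 2 * `|invmx M0| by near: M.
  by rewrite mulmxA mulmxBr mulVmx // mulmxBl mulmxK // mul1mx.
by rewrite -[leRHS]mulr1; near: M; exact: n.
Unshelve. all: by end_near. Qed.

(** With i1, i2 the inverses of the two values f1, f2, w the inverse at [a] and d the [df] term, i1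
    (f1 - f2) i2 = i2 - i1; hence the error is minus the sum of i1 (f1 - f2 - d) i2, (i1 - w) d i2
    and w d (i2 - w). *)
Lemma strict_diff_invmx p (f df : V -> 'M[F]_p) a :
  f a \in unitmx -> strict_diff f df a ->
  strict_diff (fun x => invmx (f x)) (fun h => - (invmx (f a) *m df h *m invmx (f a))) a.
Proof.
move=> u0 fD; have [dfb fn] := fD.
have fc := strict_diff_continuous fD.
have fu : \forall x \near a, f x \in unitmx.
  exact: fc (unitmx_near u0).
have ic : {for a, continuous (fun x => invmx (f x))}.
  by apply: (@continuous_comp _ _ _ f (@invmx F p)) => //; exact: invmx_continuous.
split.
  apply: bounded_linearN.
  apply: (bounded_linear_comp (f := fun X => invmx (f a) *m X *m invmx (f a)) _ dfb).
  apply: bounded_linear_mx => k u v.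
  by rewrite mulmxDr mulmxDl -scalemxAr -scalemxAl.
have i1 := continuous_near_fst ic; have i2 := continuous_near_snd ic.
pose proof (continuous_dominated1 i1) as d1.
pose proof (continuous_dominated1 i2) as d2.
pose proof (bounded_linear_dominated a dfb) as dd.
pose proof (negligible_mulr1 (mulmx_negligible_dominated
   (negligible_mul1r (mulmx_dominated_negligible d1 fn)) d2)) as n1.
pose proof (dominated_mulr1 (mulmx_dominated dd d2)) as dd2.
pose proof (negligible_mul1r (mulmx_negligible_dominated (continuous_negligible1 i1) dd2)) as n2.
have wd : dominated (nbhs (a, a)) (fun=> 1) (fun _ : V * V => invmx (f a)).
  by apply: continuous_dominated1; exact: cvg_cst.
pose proof (negligible_mul1r (mulmx_dominated_negligible wd
  (negligible_mulr1 (mulmx_dominated_negligible dd (continuous_negligible1 i2))))) as n3.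
apply: negligible_eq (negligibleN (negligibleD n1 (negligibleD n2 n3))).
have fu1 := near_fst fu; have fu2 := near_snd fu.
near=> t => /=.
have u1 : f t.1 \in unitmx by near: t.
have u2 : f t.2 \in unitmx by near: t.
set w := invmx (f a); set d := df _.
rewrite !(mulmxBr, mulmxBl) mulVmx // mul1mx mulmxK // !mulmxA.
by rewrite !addrA !subrK !opprB opprK addrC.
Unshelve. all: by end_near. Qed.

End MatrixStrictDifferential.

(** * Implicit functions of fixed-point equations *)

Section ImplicitFunction.
Context {F : realType}.

(** Only the equation near [(a, b)] matters: continuity of [g] at [a] keeps [(x, g x)] in the region
    of agreement. *)
Lemma implicit_function_eq_near (U V : topologicalType) (E E' : U -> V -> Prop) a b g :
  (\forall p \near (a, b), E p.1 p.2 <-> E' p.1 p.2) ->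
  implicit_function E a b g -> implicit_function E' a b g.
Proof.
move=> [[S' W'] /= [S'a W'b] EE'] [gab gc [S [W [Sa Wb SW]]]]; split=> //.
exists (S `&` S' `&` [set x | W' (g x)]), (W `&` W'); split.
- by apply: filterI; [exact: filterI|apply: gc; rewrite gab].
- exact: filterI.
- move=> x [[Sx S'x] W'gx]; have [Wgx gu] := SW x Sx.
  split=> // y [Wy W'y]; rewrite -gu //.
  by apply: iff_sym; apply: (EE' (x, y)).
Qed.

Section FixedPoint.
Context {U : normedModType F} {V : completeNormedModType F}.
Variables (Phi : U * V -> V) (D : U -> V) (a : U) (b : V).
Hypotheses (PhiD : strict_diff Phi (fun h => D h.1) (a, b)) (Phiab : Phi (a, b) = b).

Lemma fixed_point_partial_bounded : bounded_linear D.
Proof.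
by have [Db _] := PhiD; exact: bounded_linear_comp Db (bounded_linear_pairl U V).
Qed.

(** Strict differentiability in terms of radii; the maximum norm of the pair is bounded by the
    sum. *)
Lemma fixed_point_expand e : 0 < e -> exists2 d, 0 < d &
  forall x y x' y', `|a - x| < d -> `|b - y| < d -> `|a - x'| < d -> `|b - y'| < d ->
    `|Phi (x, y) - Phi (x', y') - D (x - x')| <= e * (`|x - x'| + `|y - y'|).
Proof.
move=> e0; have [_ /(_ e e0) /nbhs_ballP [d /= d0 hd]] := PhiD.
exists d => // x y x' y' xd yd xd' yd'.
have := hd ((x, y), (x', y')); rewrite /= => /(_ _) /le_trans -> //.
  by split; split; rewrite /= -ball_normE.
by rewrite ler_wpM2l ?(ltW e0) // prod_normE /= ge_max lerDl lerDr !normr_ge0.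
Qed.

(** The expansion with constant 1/2 bounds the distance of [y] to [b] by half of itself plus
    [k + 1/2] times that of [x] to [a]; absorbing the half gives [K = 2 * k + 1]. *)
Lemma fixed_point_lipschitz : exists2 K, 0 < K & exists2 d, 0 < d &
  forall x y, `|a - x| < d -> `|b - y| < d -> y = Phi (x, y) -> `|b - y| <= K * `|a - x|.
Proof.
have [_ [k k0 Dk]] := fixed_point_partial_bounded.
have [d d0 hd] := @fixed_point_expand 2^-1 ltac:(by rewrite invr_gt0).
exists (2 * k + 1); first by rewrite ltr_wpDl // mulr_ge0.
exists d => // x y xd yd yE.
have := hd a b x y; rewrite !subrr !normr0 Phiab -yE => /(_ d0 d0 xd yd) h1.
have h3 := Dk (a - x).
have := lerB_dist (b - y) (D (a - x)); lra.
Qed.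

(** Compare [(x, g x)] with [(a, b)] in the expansion of [Phi]; the Lipschitz bound turns the error
    in [g x] into one in [x]. *)
Lemma implicit_fixed_point_diff g :
  implicit_function (fun x y => y = Phi (x, y)) a b g -> is_diff a g D.
Proof.
move=> [gab gc [S [W [Sa Wb SW]]]].
apply: is_diff_bounded_linear; first exact: fixed_point_partial_bounded.
move=> e e0; have [K K0 [d d0 hK]] := fixed_point_lipschitz.
have K1 : 0 < 1 + K by rewrite addr_gt0.
(* The error is measured by the sum of both distances, at most [1 + K] times that of [x] to [a]. *)
have eK0 : 0 < e / (1 + K) by rewrite divr_gt0.
have [d' d'0 hd'] := fixed_point_expand eK0.
have gE : \forall x \near a, g x = Phi (x, g x).
  by apply: filterS Sa => x Sx; have [Wgx gu] := SW x Sx; apply/gu.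
have gcl r : 0 < r -> \forall x \near a, `|b - g x| < r.
  by move=> r0; move: gc; rewrite /prop_for /continuous_at gab => /cvgrPdist_lt; apply.
have idl r : 0 < r -> \forall x \near a, `|a - x| < r.
  by move=> r0; apply: cvgr_dist_lt => //; exact: cvg_id.
have g1 := gcl _ d0; have g2 := gcl _ d'0; have a1 := idl _ d0; have a2 := idl _ d'0.
near=> x.
have gxE : g x = Phi (x, g x) by near: x.
have x1 : `|a - x| < d by near: x.
have x2 : `|a - x| < d' by near: x.
have y1 : `|b - g x| < d by near: x.
have y2 : `|b - g x| < d' by near: x.
have := hd' x (g x) a b; rewrite !subrr !normr0 -gxE Phiab => /(_ x2 y2 d'0 d'0).
rewrite gab => /le_trans; apply.
have := hK x (g x) x1 y1 gxE; rewrite distrC [in leRHS]distrC => h.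
apply: (@le_trans _ _ (e / (1 + K) * (`|x - a| + K * `|x - a|))).
  by rewrite ler_wpM2l ?(ltW eK0) // lerD2l.
by rewrite -{1}[`|x - a|]mul1r -mulrDl mulrA divfK // gt_eqF.
Unshelve. all: by end_near. Qed.

(** For [x] near [a], [Phi (x, -)] contracts one fixed closed ball about [b] with ratio 1/2; its
    Banach fixed point is [g x]. *)
Lemma implicit_fixed_point_exists :
  exists g, implicit_function (fun x y => y = Phi (x, y)) a b g.
Proof.
have [_ [k k0 Dk]] := fixed_point_partial_bounded.
have [K K0 [dK dK0 hK]] := fixed_point_lipschitz.
have [d0 d00 hd] := @fixed_point_expand 2^-1 ltac:(by rewrite invr_gt0).
(* Halving puts the closed ball of radius [r] strictly inside both radii. *)
pose r := Num.min d0 dK / 2.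
have m0 : 0 < Num.min d0 dK by rewrite lt_min d00.
have r0 : 0 < r by rewrite divr_gt0.
have rm : r < Num.min d0 dK by rewrite /r; lra.
have [rd rK] : r < d0 /\ r < dK by move: rm; rewrite lt_min => /andP.
(* Chosen so that [k * s + (s + r) / 2 <= r], which makes [C] stable under [Phi (x, -)]. *)
pose s := r / (2 * k + 2).
have k2 : 0 < 2 * k + 2 by lra.
have s0 : 0 < s by rewrite divr_gt0.
have sE : s * (2 * k + 2) = r by rewrite divfK // gt_eqF.
have sr : s <= r by rewrite -sE ler_peMr ?(ltW s0) //; lra.
pose C := closed_ball_ Num.norm b r.
have contract x y y' : `|a - x| < s -> C y -> C y' ->
    `|Phi (x, y) - Phi (x, y')| <= 2^-1 * `|y - y'|.
  rewrite /C /closed_ball_ /= => xs yr y'r; have := hd x y x y'.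
  rewrite !subrr (linear_eq0 fixed_point_partial_bounded.1) subr0 normr0 add0r.
  by apply; lra.
have stable x y : `|a - x| < s -> C y -> C (Phi (x, y)).
  rewrite /C /closed_ball_ /= => xs yr; have := hd a b x y.
  rewrite !subrr !normr0 Phiab => /(_ d00 d00) h; have {}h := h ltac:(lra) ltac:(lra).
  have h3 := Dk (a - x).
  have h4 := lerB_dist (b - Phi (x, y)) (D (a - x)).
  have h5 : k * `|a - x| <= k * s by rewrite ler_wpM2l // ltW.
  lra.
(* The implication is inside the existential, so that choice yields a total [g]; far from [a] the
   witness [b] is a filler. *)
have ex x : exists y, `|a - x| < s -> C y /\ y = Phi (x, y).
  have [xs|xs] := boolP (`|a - x| < s); last by exists b.
  have Cf : set_fun C C (fun y => Phi (x, y)) by move=> y; exact: stable.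
  pose fM := isFun.Build V V C C _ Cf.
  pose f : {fun C >-> C} := HB.pack (fun y => Phi (x, y)) fM.
  have fC : is_contraction f.
    exists (2^-1)%:nng; split=> [/=|]; first by rewrite invf_lt1 // ltr1n.
    by move=> [y y'] [/= Cy Cy']; exact: contract.
  have [||y Cy yE] := banach_fixed_point fC.
  - exact: closed_closed_ball_.
  - by exists b; rewrite /C /closed_ball_ /= subrr normr0 ltW.
  by exists y.
pose g x := sval (cid (ex x)).
have gP x : `|a - x| < s -> C (g x) /\ g x = Phi (x, g x) by exact: svalP (cid (ex x)).
have uniq x y : `|a - x| < s -> C y -> y = Phi (x, y) -> y = g x.
  move=> xs Cy yE; have [Cg gE] := gP x xs.
  have := contract x y (g x) xs Cy Cg; rewrite -yE -gE => h.
  by apply/subr0_eq/normr0_eq0/eqP; rewrite eq_le normr_ge0 andbT; lra.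
have gab : g a = b.
  apply/esym/uniq; rewrite ?subrr ?normr0 // /C /closed_ball_ /= subrr normr0.
  exact: ltW.
have ball_nbhs (X : normedModType F) (x0 : X) e : 0 < e -> nbhs x0 [set x | `|x0 - x| < e].
  by move=> e0; apply/nbhs_ballP; exists e => //= x; rewrite -ball_normE.
exists g; split=> //.
- apply/(@cvgrPdist_lt _ _ _ (nbhs a)) => e e0; rewrite gab.
  have as1 := ball_nbhs _ a s s0.
  have as2 := ball_nbhs _ a (K^-1 * e) ltac:(by rewrite mulr_gt0 // invr_gt0).
  near=> x.
  have xs : `|a - x| < s by near: x.
  have [Cg gE] := gP x xs; rewrite /C /closed_ball_ /= in Cg.
  have := hK x (g x) ltac:(lra) ltac:(lra) gE => /le_lt_trans; apply.
  by rewrite -ltr_pdivlMl //; near: x.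
- exists [set x | `|a - x| < s], C; split; first exact: ball_nbhs.
    by apply: filterS (ball_nbhs _ b r r0) => y; exact: ltW.
  move=> x xs; have [Cg gE] := gP x xs; split=> // y Cy.
  by split=> [yE|->//]; exact: uniq.
Unshelve. all: by end_near. Qed.

End FixedPoint.
End ImplicitFunction.

(** * Linearity and inverse of vectorization *)

Section VecTheory.
Context {F : fieldType}.

Definition unvec p q (v : 'cV[F]_(q * p)) : 'M[F]_(p, q) := (vec_mx v^T)^T.

Lemma vecK p q : cancel (@vec F p q) (@unvec p q).
Proof. by move=> X; rewrite /unvec /vec trmxK mxvecK trmxK. Qed.

Lemma unvecK p q : cancel (@unvec p q) (@vec F p q).
Proof. by move=> v; rewrite /unvec /vec trmxK vec_mxK trmxK. Qed.

Lemma vec0 p q : vec (0 : 'M[F]_(p, q)) = 0.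
Proof. by rewrite /vec !linear0. Qed.

Lemma vecD p q : {morph @vec F p q : X Y / X + Y}.
Proof. by move=> X Y; rewrite /vec !linearD. Qed.

Lemma vecB p q : {morph @vec F p q : X Y / X - Y}.
Proof. by move=> X Y; rewrite /vec !linearB. Qed.

Lemma vecZ p q k (X : 'M[F]_(p, q)) : vec (k *: X) = k *: vec X.
Proof. by rewrite /vec !linearZ. Qed.

Lemma unvecP p q k (u v : 'cV[F]_(q * p)) : @unvec p q (k *: u + v) = k *: unvec u + unvec v.
Proof. by rewrite /unvec !linearP. Qed.

Lemma tprod_vec p q r s (W : 'M[F]_(s, r)) (X : 'M[F]_(p, q)) (Y : 'M[F]_(q, r)) :
  (W ⊗ X) *m vec Y = vec (X *m Y *m W^T).
Proof. by rewrite vec_mulmx trmxK. Qed.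

End VecTheory.

(** * The differential of the Riccati map and its matrices *)

Section RiccatiDifferential.
Context {F : realType} {n m : nat}.
Variables (A : 'M[F]_n) (B : 'M[F]_(n, m)) (R : 'M[F]_m) (P : 'M[F]_n).
Implicit Types (dA dQ dP : 'M[F]_n) (dB : 'M[F]_(n, m)) (dR : 'M[F]_m).

Let N := M2 B R P.

(** The total differential of the right-hand side of the DARE, in the shape that the product and
    inverse rules return, so that the two later match by conversion. *)
Definition riccati_diff dA dB dQ dR dP : 'M[F]_n :=
  let dM3 := dR + ((dB^T *m P + B^T *m dP) *m B + B^T *m P *m dB) in
  let dM2 := - (N *m dM3 *m N) in
  (dA^T *m P + A^T *m dP) *m A + A^T *m P *m dA
  - ((((dA^T *m P + A^T *m dP) *m B + A^T *m P *m dB) *m N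
       + A^T *m P *m B *m dM2) *m (B^T *m P *m A)
     + A^T *m P *m B *m N *m ((dB^T *m P + B^T *m dP) *m A + B^T *m P *m dA))
  + dQ.

Hypotheses (symP : P^T = P) (symR : R^T = R).

(** Symmetry of [N] and [P] identifies the factors transposed by the vectorization rule with those
    in the Z matrices. *)
Let symN : N^T = N.
Proof. by rewrite /N /M2 trmx_inv /M3 linearD /= symR !trmx_mul trmxK symP mulmxA. Qed.

Let simp0 := (trmx0, mul0mx, mulmx0, add0r, addr0, sub0r, oppr0, subr0).
Let expand := (mulmxDl, mulmxDr, mulmxBl, mulmxBr, mulNmx, mulmxN, mulmxA, mul1mx, mulmx1).
Let tr := (@trmx_mul, @trmxK, symP, symN, trmx1).

Let trmxB p q (X Y : 'M[F]_(p, q)) : (X - Y)^T = X^T - Y^T.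
Proof. exact: linearB. Qed.

(** The [dP] part factors as A^T (1 - P B N B^T) dP (1 - B N B^T P) A; its four terms are those of
    the bracket in [Z1]. *)
Lemma vec_riccati_diffP dP :
  vec (dP - riccati_diff 0 0 0 0 dP) = Z1 A B R P *m vec dP.
Proof.
rewrite /Z1 -/N !(mulmxBl, mulmxDl, mul1mx) -!mulmxA !(mulmxBl, mulmxDl, mul1mx).
rewrite -!mulmxA !tprod_vec -!(vecB, vecD) tprod_vec -vecB; congr vec.
rewrite /riccati_diff !simp0 !tr !expand.
congr (_ - _); rewrite opprD opprB [_ *m A - _]addrC.
by rewrite !addrA addrAC.
Qed.

(** The differential is [A^T *m M1 B R P *m dA] plus its transpose, hence the commutation matrix. *)
Lemma vec_riccati_diffA dA :
  vec (riccati_diff dA 0 0 0 0) = Z2 A B R P *m vec dA.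
Proof.
rewrite /Z2 -mulmxA tprod_vec mulmxDl commutation_mx_vec mul1mx -vecD /M1 -/N; congr vec.
rewrite /riccati_diff !simp0 !(tr, trmxB, mulmxBr, mulmxA) !expand.
by rewrite opprD addrACA.
Qed.

(** Two transposed pairs arise: one from [dM3] inside the inverse, one from the outer occurrences of
    [B]. *)
Lemma vec_riccati_diffB dB :
  vec (riccati_diff 0 dB 0 0 0) = Z3 A B R P *m vec dB.
Proof.
rewrite /Z3 -/N -!mulmxA mulmxBl -!mulmxA !tprod_vec.
rewrite !(mulmxDl _ _ (vec _)) !mul1mx !commutation_mx_vec -!vecD !tprod_vec -vecB tprod_vec.
congr vec.
rewrite /riccati_diff !simp0 !tr !expand.
by rewrite opprD opprB -addrA -opprD [X in X - _ = _]addrC.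
Qed.

Lemma vec_riccati_diffQ dQ :
  vec (riccati_diff 0 0 dQ 0 0) = Z4 *m vec dQ.
Proof. by rewrite /riccati_diff !simp0 mul1mx. Qed.

(** The minus sign from differentiating the inverse cancels that of the DARE. *)
Lemma vec_riccati_diffR dR :
  vec (riccati_diff 0 0 0 dR 0) = Z5 A B R P *m vec dR.
Proof.
rewrite /Z5 -/N -!mulmxA !tprod_vec; congr vec.
rewrite /riccati_diff !simp0 !tr !expand.
by rewrite opprK.
Qed.

End RiccatiDifferential.

(** * Strict differentiability of the Riccati map *)

Section RiccatiMap.
Context {F : realType} {n m : nat}.

Notation point := ('M[F]_n * 'M[F]_(n, m) * 'M[F]_n * 'M[F]_m * 'M[F]_n)%type.

Let cA (p : point) := p.1.1.1.1.
Let cB (p : point) := p.1.1.1.2.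
Let cQ (p : point) := p.1.1.2.
Let cR (p : point) := p.1.2.
Let cP (p : point) := p.2.

Definition riccati_map (p : point) : 'M[F]_n :=
  let A := p.1.1.1.1 in let B := p.1.1.1.2 in let Q := p.1.1.2 in
  let R := p.1.2 in let P := p.2 in
  A^T *m P *m A - A^T *m P *m B *m M2 B R P *m (B^T *m P *m A) + Q.

Lemma DARE_riccati_map (A : 'M[F]_n) (B : 'M[F]_(n, m)) Q R P :
  DARE A B Q R P <-> M3 B R P \in unitmx /\ P = riccati_map (A, B, Q, R, P).
Proof. by rewrite /DARE /riccati_map /M2 /= /M3 !mulmxA. Qed.

Lemma strict_diff_trmx (V : normedModType F) p q (f df : V -> 'M[F]_(p, q)) a :
  strict_diff f df a -> strict_diff (fun x => (f x)^T) (fun h => (df h)^T) a.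
Proof.
apply: strict_diff_comp_linear; apply: bounded_linear_mx.
exact: (@linearP _ _ _ _ (@trmx F p q)).
Qed.

Variables (A : 'M[F]_n) (B : 'M[F]_(n, m)) (Q : 'M[F]_n) (R : 'M[F]_m) (P : 'M[F]_n).
Let p0 : point := (A, B, Q, R, P).

Let strict_cA : strict_diff cA cA p0.
Proof. exact: strict_diff_linear _
  (bounded_linear_fst (bounded_linear_fst (bounded_linear_fst
    (bounded_linear_fst (bounded_linear_id _))))). Qed.

Let strict_cB : strict_diff cB cB p0.
Proof. exact: strict_diff_linear _
  (bounded_linear_snd (bounded_linear_fst (bounded_linear_fst
    (bounded_linear_fst (bounded_linear_id _))))). Qed.

Let strict_cQ : strict_diff cQ cQ p0.
Proof. exact: strict_diff_linear _
  (bounded_linear_snd (bounded_linear_fst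
    (bounded_linear_fst (bounded_linear_id _)))). Qed.

Let strict_cR : strict_diff cR cR p0.
Proof. exact: strict_diff_linear _
  (bounded_linear_snd (bounded_linear_fst (bounded_linear_id _))). Qed.

Let strict_cP : strict_diff cP cP p0.
Proof. exact: strict_diff_linear _
  (bounded_linear_snd (bounded_linear_id _)). Qed.

Let strict_M3 := strict_diffD strict_cR
  (strict_diff_mulmx (strict_diff_mulmx (strict_diff_trmx strict_cB) strict_cP) strict_cB).

Lemma strict_diff_riccati_map : M3 B R P \in unitmx ->
  strict_diff riccati_map
    (fun h : point =>
       riccati_diff A B R P h.1.1.1.1 h.1.1.1.2 h.1.1.2 h.1.2 h.2) p0.
Proof.
move=> u3.
have sAP := strict_diff_mulmx (strict_diff_trmx strict_cA) strict_cP.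
have sBP := strict_diff_mulmx (strict_diff_trmx strict_cB) strict_cP.
have sI := (fun u => strict_diff_invmx u strict_M3) u3.
exact: strict_diffD (strict_diffD (strict_diff_mulmx sAP strict_cA)
  (strict_diffN (strict_diff_mulmx (strict_diff_mulmx (strict_diff_mulmx sAP strict_cB) sI)
    (strict_diff_mulmx sBP strict_cA)))) strict_cQ.
Qed.

(** Invertibility is an open condition, so near the data [DARE] reduces to its fixed-point
    equation. *)
Lemma M3_unit_near : M3 B R P \in unitmx ->
  \forall p \near p0, M3 (cB p) (cR p) (cP p) \in unitmx.
Proof.
by move=> u3; exact: (strict_diff_continuous strict_M3 (unitmx_near u3)).
Qed.

End RiccatiMap.

(** The chain rule, meant for an [i] that inserts one argument among fixed values of the others. *)
Lemma has_jacobian_comp (F : realType) (U : normedModType F) p q r s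
    (g Dg : U -> 'M[F]_(r, s)) (i Di : 'M[F]_(p, q) -> U) X J :
  is_diff X i Di -> is_diff (i X) g Dg ->
  (forall dX, vec (Dg (Di dX)) = J *m vec dX) ->
  has_jacobian (fun Y => g (i Y)) X J.
Proof.
move=> iD gD DJ; have [d dE] : is_diff X (g \o i) (Dg \o Di) by exact: is_diff_comp.
by split=> // dX; rewrite -DJ -[LHS]/(vec ('d (g \o i) X dX)) dE.
Qed.

(** * The simplified Newton map and the partial Jacobians *)

Section DAREFixedPoint.
Context {F : realType} {n m : nat}.
Variables (A : 'M[F]_n) (B : 'M[F]_(n, m)) (Q : 'M[F]_n) (R : 'M[F]_m) (P : 'M[F]_n).

Notation data := ('M[F]_n * 'M[F]_(n, m) * 'M[F]_n * 'M[F]_m)%type.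

Definition Z1_solve (X : 'M[F]_n) : 'M[F]_n := unvec (invmx (Z1 A B R P) *m vec X).

Definition newton_map (p : data * 'M[F]_n) : 'M[F]_n :=
  p.2 - Z1_solve (p.2 - riccati_map p).

(** For invertible [Z1], this is the solution [dP] of the linearized DARE with data increment
    [h]. *)
Definition DARE_diff (h : data) : 'M[F]_n :=
  Z1_solve (riccati_diff A B R P h.1.1.1 h.1.1.2 h.1.2 h.2 0).

Lemma bounded_linear_Z1_solve : bounded_linear Z1_solve.
Proof.
apply: bounded_linear_mx => k X Y.
by rewrite /Z1_solve vecD vecZ mulmxDr -scalemxAr unvecP.
Qed.

Lemma Z1_solve0 : Z1_solve 0 = 0.
Proof. exact: linear_eq0 bounded_linear_Z1_solve.1. Qed.

Hypotheses (symP : P^T = P) (symR : R^T = R).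
Hypotheses (M3_unit : M3 B R P \in unitmx) (Z1_unit : Z1 A B R P \in unitmx).

Lemma Z1_solve_eq0 X : Z1_solve X = 0 -> X = 0.
Proof.
move=> /(congr1 (@vec _ _ _)); rewrite unvecK => /(congr1 (mulmx (Z1 A B R P))).
by rewrite mulKVmx // vec0 mulmx0 -vec0 => /(can_inj (@vecK _ _ _)).
Qed.

(** [Z1_solve] is injective, so a fixed point has zero Riccati residual. *)
Lemma newton_map_fixed (A' : 'M[F]_n) (B' : 'M[F]_(n, m)) Q' R' P' :
  M3 B' R' P' \in unitmx ->
  DARE A' B' Q' R' P' <-> P' = newton_map (A', B', Q', R', P').
Proof.
move=> u; rewrite DARE_riccati_map /newton_map /=.
split=> [[_ <-]|/eqP]; first by rewrite subrr Z1_solve0 subr0.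
rewrite -subr_eq0 opprB addrC subrK => /eqP/Z1_solve_eq0/subr0_eq P'E.
by split.
Qed.

(** Linearity is part of strict differentiability, which spares expanding the formula. *)
Lemma riccati_diff_split dA dB dQ dR dP :
  riccati_diff A B R P dA dB dQ dR dP =
  riccati_diff A B R P dA dB dQ dR 0 + riccati_diff A B R P 0 0 0 0 dP.
Proof.
have [[rl _] _] := strict_diff_riccati_map A Q M3_unit.
have := linear_eqD rl (dA, dB, dQ, dR, 0) (0, 0, 0, 0, dP).
by rewrite /= !addr0 add0r.
Qed.

Lemma strict_diff_newton_map :
  strict_diff newton_map (fun h => DARE_diff h.1) (A, B, Q, R, P).
Proof.
have sM := strict_diff_riccati_map A Q M3_unit.
have sP := strict_diff_linear (A, B, Q, R, P)
  (bounded_linear_snd (bounded_linear_id (data * 'M[F]_n : normedModType F)%type)).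
have [Ll _] := bounded_linear_Z1_solve.
apply: strict_diff_eq (strict_diffD sP (strict_diffN
  (strict_diff_comp_linear bounded_linear_Z1_solve (strict_diffD sP (strict_diffN sM))))).
move=> [h k] /=; rewrite riccati_diff_split opprD addrCA (linear_eqD Ll) opprD.
(* [Z1_solve] inverts exactly this operator, so the contributions of [k] cancel. *)
have -> : Z1_solve (k - riccati_diff A B R P 0 0 0 0 k) = k.
  by rewrite /Z1_solve vec_riccati_diffP // mulKmx // vecK.
by rewrite addrCA subrr addr0 -[- riccati_diff _ _ _ _ _ _ _ _ _]sub0r
  (linear_eqB Ll) Z1_solve0 sub0r opprK.
Qed.

Lemma implicit_DARE_newton_map g :
  implicit_function (fun D : data => let: (A', B', Q', R') := D in DARE A' B' Q' R')
    (A, B, Q, R) P g <->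
  implicit_function (fun D P' => P' = newton_map (D, P')) (A, B, Q, R) P g.
Proof.
have E : \forall p \near ((A, B, Q, R), P),
    (let: (A', B', Q', R') := p.1 in DARE A' B' Q' R') p.2 <-> p.2 = newton_map (p.1, p.2).
  apply: filterS (M3_unit_near A Q M3_unit) => -[[[[A' B'] Q'] R'] P'] /=.
  exact: newton_map_fixed.
split; first exact: implicit_function_eq_near.
by apply: implicit_function_eq_near; apply: filterS E => p; exact: iff_sym.
Qed.

Lemma vec_DARE_diff (h : data) p q (J : 'M[F]_(n * n, q * p)) (X : 'M[F]_(p, q)) :
  vec (riccati_diff A B R P h.1.1.1 h.1.1.2 h.1.2 h.2 0) = J *m vec X ->
  vec (DARE_diff h) = invmx (Z1 A B R P) *m J *m vec X.
Proof. by rewrite /DARE_diff unvecK -mulmxA => ->. Qed.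

(** The slice through the data has differential [dX] in one slot and 0 elsewhere, which leaves one
    vectorization identity; likewise for the other three arguments. *)
Lemma has_jacobian_DARE_A (g : data -> 'M[F]_n) : is_diff (A, B, Q, R) g DARE_diff ->
  has_jacobian (fun X => g (X, B, Q, R)) A (invmx (Z1 A B R P) *m Z2 A B R P).
Proof.
move=> gD; apply: (has_jacobian_comp
  (is_diff_pair (is_diff_pair (is_diff_pair (is_diff_id _) (is_diff_cst B _))
    (is_diff_cst Q _)) (is_diff_cst R _)) gD) => dX.
by apply: vec_DARE_diff; exact: vec_riccati_diffA.
Qed.

Lemma has_jacobian_DARE_B (g : data -> 'M[F]_n) : is_diff (A, B, Q, R) g DARE_diff ->
  has_jacobian (fun X => g (A, X, Q, R)) B (invmx (Z1 A B R P) *m Z3 A B R P).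
Proof.
move=> gD; apply: (has_jacobian_comp
  (is_diff_pair (is_diff_pair (is_diff_pair (is_diff_cst A _) (is_diff_id _))
    (is_diff_cst Q _)) (is_diff_cst R _)) gD) => dX.
by apply: vec_DARE_diff; exact: vec_riccati_diffB.
Qed.

Lemma has_jacobian_DARE_Q (g : data -> 'M[F]_n) : is_diff (A, B, Q, R) g DARE_diff ->
  has_jacobian (fun X => g (A, B, X, R)) Q (invmx (Z1 A B R P) *m Z4).
Proof.
move=> gD; apply: (has_jacobian_comp
  (is_diff_pair (is_diff_pair (is_diff_pair (is_diff_cst A _) (is_diff_cst B _))
    (is_diff_id _)) (is_diff_cst R _)) gD) => dX.
by apply: vec_DARE_diff; exact: vec_riccati_diffQ.
Qed.

Lemma has_jacobian_DARE_R (g : data -> 'M[F]_n) : is_diff (A, B, Q, R) g DARE_diff ->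
  has_jacobian (fun X => g (A, B, Q, X)) R (invmx (Z1 A B R P) *m Z5 A B R P).
Proof.
move=> gD; apply: (has_jacobian_comp
  (is_diff_pair (is_diff_pair (is_diff_pair (is_diff_cst A _) (is_diff_cst B _))
    (is_diff_cst Q _)) (is_diff_id _)) gD) => dX.
by apply: vec_DARE_diff; exact: vec_riccati_diffR.
Qed.

End DAREFixedPoint.

Theorem proposition2 (F : realType) (n m : nat)
    (A : 'M[F]_n) (B : 'M[F]_(n, m)) (Q : 'M[F]_n) (R : 'M[F]_m) (P : 'M[F]_n)
    (psdQ : psd Q) (psdR : psd R)
    (symP : P^T = P) (stabP : stabilizing_solution A B Q R P)
    (M3_unit : M3 B R P \in unitmx) (Z1_unit : Z1 A B R P \in unitmx) :
  let is_DARE_function := implicit_function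
    (fun D : 'M[F]_n * 'M[F]_(n, m) * 'M[F]_n * 'M[F]_m =>
       let: (A', B', Q', R') := D in DARE A' B' Q' R')
    (A, B, Q, R) P in
  (exists Pf, is_DARE_function Pf) /\
  forall Pf, is_DARE_function Pf ->
    differentiable Pf (A, B, Q, R) /\
    [/\ has_jacobian (fun X => Pf (X, B, Q, R)) A (invmx (Z1 A B R P) *m Z2 A B R P),
        has_jacobian (fun X => Pf (A, X, Q, R)) B (invmx (Z1 A B R P) *m Z3 A B R P),
        has_jacobian (fun X => Pf (A, B, X, R)) Q (invmx (Z1 A B R P) *m Z4)
      & has_jacobian (fun X => Pf (A, B, Q, X)) R (invmx (Z1 A B R P) *m Z5 A B R P)].
Proof.
have [symR _] := psdR; have [DP _] := stabP.
have Pfix : newton_map A B R P (A, B, Q, R, P) = P.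
  by apply/esym; apply/newton_map_fixed.
have nD := strict_diff_newton_map Q symP symR M3_unit Z1_unit.
split.
  have [g gP] := implicit_fixed_point_exists nD Pfix.
  by exists g; apply/implicit_DARE_newton_map.
move=> g /(implicit_DARE_newton_map Q M3_unit Z1_unit) gP.
(* This covers an arbitrary implicit function, not only the one built by Banach's theorem. *)
have gD := implicit_fixed_point_diff nD Pfix gP.
split; first exact: ex_diff.
split.
- exact: has_jacobian_DARE_A.
- exact: has_jacobian_DARE_B.
- exact: has_jacobian_DARE_Q.
- exact: has_jacobian_DARE_R.
Qed.
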